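(* Let $G$ be an integrable group. Then $\mathrm{Inn}(G)\le \mathrm{Aut}(G)'$; indeed, $\mathrm{Inn}(G)$ has an integral within $\mathrm{Aut}(G)$, i.e. there is a subgroup of $\mathrm{Aut}(G)$ which is an integral of $\mathrm{Inn}(G)$.
   Context: For a group $H$, $H'$ denotes the derived group (commutator subgroup) of $H$. An integral of a group $G$ is a group $H$ such that $H' \cong G$. A group is integrable if it has an integral. $\mathrm{Aut}(G)$ and $\mathrm{Inn}(G)$ are the automorphism group and the inner automorphism group of $G$. Groups may be infinite. *)

(* Defs.v *)
From HB Require Import structures.
From mathcomp Require Import all_boot monoid boolp.

Set Implicit Arguments.
Unset Strict Implicit.
Unset Printing Implicit Defensive.

Local Open Scope group_scope.

(* [groupType] does not require finiteness; a subgroup of [G] is a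
   [groupClosed G], and [subgroup_type S] is [S] as a group in its own right. *)
Definition subgroup_type (G : groupType) (S : {pred G}) := {x : G | x \in S}.
Arguments subgroup_type {G} S.

Lemma groupClosed_closed (G : groupType) (S : groupClosed G) :
  group_closed (fun x : G => x \in S).
Proof. by split=> [|x y xS yS]; [exact: gpred1 | exact: gpredF]. Qed.

HB.instance Definition _ (G : groupType) (S : {pred G}) :=
  SubChoice.on (subgroup_type S).
HB.instance Definition _ (G : groupType) (S : groupClosed G) :=
  SubChoice_isSubGroup.Build G _ (subgroup_type S) (groupClosed_closed S).

Definition isomorphic (G H : groupType) : Prop :=
  exists f : UMagmaMorphism.type G H, bijective f.

(* The subgroup generated by the commutators, as the intersection of the
   subgroups that contain them. *)
Definition derived (G : groupType) : {pred G} :=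
  fun x => `[< forall S : groupClosed G,
                 (forall y z : G, [~ y, z] \in S) -> x \in S >].
Arguments derived : clear implicits.

Section Derived.
Variable G : groupType.

Lemma derivedP (x : G) :
  reflect (forall S : groupClosed G,
             (forall y z : G, [~ y, z] \in S) -> x \in S)
          (x \in derived G).
Proof. exact: asboolP. Qed.

Lemma derived1 : 1 \in derived G.
Proof. by apply/derivedP => S _; exact: gpred1. Qed.

Lemma derivedM : mulg_closed (derived G).
Proof.
move=> x y /derivedP xD /derivedP yD; apply/derivedP => S cS.
by apply: gpredM; [exact: xD | exact: yD].
Qed.

Lemma derivedV : invg_closed (derived G).
Proof. by move=> x /derivedP xD; apply/derivedP => S cS; apply/gpredVr/xD. Qed.

(* [isMulClosed] must come before [isMul1Closed], otherwise the [GroupClosed]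
   structure is not built. *)
HB.instance Definition _ := isMulClosed.Build G (derived G) derivedM.
HB.instance Definition _ := isMul1Closed.Build G (derived G) derived1.
HB.instance Definition _ := isInvClosed.Build G (derived G) derivedV.

End Derived.

Definition is_integral_of (H G : groupType) : Prop :=
  isomorphic (subgroup_type (derived H)) G.

Definition integrable (G : groupType) : Prop :=
  exists H : groupType, is_integral_of H G.

Definition is_aut (G : groupType) : {pred G -> G} :=
  fun f => `[< monoid_morphism f /\ bijective f >].
Arguments is_aut : clear implicits.

Record aut (G : groupType) :=
  Aut { aut_fun :> G -> G; _ : aut_fun \in is_aut G }.

HB.instance Definition _ (G : groupType) := [isSub for @aut_fun G].
HB.instance Definition _ (G : groupType) := [Choice of aut G by <:].

Section AutGroup.
Variable G : groupType.
Implicit Types f g h : aut G.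

Lemma is_autP (f : G -> G) :
  reflect (monoid_morphism f /\ bijective f) (f \in is_aut G).
Proof. exact: asboolP. Qed.

Lemma autP f g : f =1 g <-> f = g.
Proof. by split=> [fg|-> //]; apply/val_inj/funext. Qed.

Lemma aut_is_morphism f : monoid_morphism f.
Proof. by case: f => f /= /is_autP []. Qed.

Lemma aut_is_bij f : bijective f.
Proof. by case: f => f /= /is_autP []. Qed.

HB.instance Definition _ f := isUMagmaMorphism.Build G G f (aut_is_morphism f).

Lemma aut_one_subproof : (idfun : G -> G) \in is_aut G.
Proof. by apply/is_autP; split; [split | exists idfun]. Qed.

Lemma aut_mul_subproof f g : g \o f \in is_aut G.
Proof.
apply/is_autP; split; last exact: bij_comp (aut_is_bij g) (aut_is_bij f).
by split=> [|x y] /=; rewrite ?gmulf1 ?gmulfM.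
Qed.

Lemma aut_inv_exists f : {g : G -> G | cancel f g & cancel g f}.
Proof. by apply: cid2; case: (aut_is_bij f) => g; exists g. Qed.

Definition aut_inv_fun f : G -> G := s2val (aut_inv_exists f).

Lemma aut_funK f : cancel f (aut_inv_fun f).
Proof. exact: s2valP (aut_inv_exists f). Qed.

Lemma aut_inv_funK f : cancel (aut_inv_fun f) f.
Proof. exact: s2valP' (aut_inv_exists f). Qed.

Lemma aut_inv_subproof f : aut_inv_fun f \in is_aut G.
Proof.
apply/is_autP; split; last by exists f; [exact: aut_inv_funK | exact: aut_funK].
have fI := can_inj (aut_funK f).
by split=> [|x y]; apply: fI; rewrite ?gmulf1 ?gmulfM /= !aut_inv_funK.
Qed.

Definition aut_one : aut G := Aut aut_one_subproof.
(* As for permutations in the library, the product composes from left to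
   right: [(f * g) x = g (f x)]. *)
Definition aut_mul f g : aut G := Aut (aut_mul_subproof f g).
Definition aut_inv f : aut G := Aut (aut_inv_subproof f).

Lemma aut_mulA : associative aut_mul.
Proof. by move=> f g h; apply/autP. Qed.
Lemma aut_mul1 : left_id aut_one aut_mul.
Proof. by move=> f; apply/autP. Qed.
Lemma aut_mulr1 : right_id aut_one aut_mul.
Proof. by move=> f; apply/autP. Qed.
Lemma aut_mulV : left_inverse aut_one aut_inv aut_mul.
Proof. by move=> f; apply/autP => x; exact: aut_inv_funK. Qed.
Lemma aut_mulrV : right_inverse aut_one aut_inv aut_mul.
Proof. by move=> f; apply/autP => x; exact: aut_funK. Qed.

HB.instance Definition _ :=
  isGroup.Build (aut G) aut_mulA aut_mul1 aut_mulr1 aut_mulV aut_mulrV.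

End AutGroup.

Definition inn (G : groupType) : {pred aut G} :=
  fun f => `[< exists g : G, forall x : G, f x = x ^ g >].
Arguments inn : clear implicits.

Section Inn.
Variable G : groupType.

Lemma innP (f : aut G) :
  reflect (exists g : G, forall x : G, f x = x ^ g) (f \in inn G).
Proof. exact: asboolP. Qed.

Lemma inn1 : 1 \in inn G.
Proof. by apply/innP; exists 1 => x; rewrite conjg1. Qed.

Lemma innM : mulg_closed (inn G).
Proof.
move=> f h /innP[a fa] /innP[b hb]; apply/innP; exists (a * b) => x.
by rewrite conjgM -fa -hb.
Qed.

Lemma innV : invg_closed (inn G).
Proof.
move=> f /innP[a fa]; apply/innP; exists a^-1 => x.
by apply: (can_inj (aut_funK f)); rewrite [LHS]aut_inv_funK fa conjgKV.
Qed.

HB.instance Definition _ := isMulClosed.Build (aut G) (inn G) innM.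
HB.instance Definition _ := isMul1Closed.Build (aut G) (inn G) inn1.
HB.instance Definition _ := isInvClosed.Build (aut G) (inn G) innV.

End Inn.

(* Main.v *)
Require Import Defs.
From HB Require Import structures.
From mathcomp Require Import all_boot monoid boolp.

(** Let [H] be an integral of [G].  The derived group of [H] is normal, so [H]
acts on it by conjugation; carried along an isomorphism [phi] from the derived
group onto [G], this action is a morphism [rho] from [H] to [aut G]
([conj_action]).  An element [n] of the derived group acts on [G] as
conjugation by [phi n] ([conj_action_inner]), and [phi] is onto, so [rho] maps
the derived group of [H] exactly onto [inn G].

The derived group is compatible with morphisms: a morphism maps the derived
group of its source into that of its target ([derived_morph]), and onto it
when the morphism is surjective ([derived_surj]).  Applied to [rho], the first
fact puts [inn G] inside the derived group of [aut G]; applied to [rho] seen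
as a surjection onto its image [K], both facts together identify the derived
group of [K] with [inn G]. *)

Set Implicit Arguments.
Unset Strict Implicit.
Unset Printing Implicit Defensive.

Local Open Scope group_scope.

Section Image.
Variables (A B : groupType) (f : UMagmaMorphism.type A B).

Definition image : {pred B} := fun y => `[< exists x, f x = y >].

Lemma imageP y : reflect (exists x, f x = y) (y \in image).
Proof. exact: asboolP. Qed.

Lemma image_f x : f x \in image.
Proof. by apply/imageP; exists x. Qed.

Lemma image1 : 1 \in image.
Proof. by apply/imageP; exists 1; rewrite gmulf1. Qed.

Lemma imageM : mulg_closed image.
Proof.
by move=> _ _ /imageP[x <-] /imageP[y <-]; rewrite -gmulfM image_f.
Qed.

Lemma imageV : invg_closed image.
Proof. by move=> _ /imageP[x <-]; rewrite -gmulfV image_f. Qed.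

HB.instance Definition _ := isMulClosed.Build B image imageM.
HB.instance Definition _ := isMul1Closed.Build B image image1.
HB.instance Definition _ := isInvClosed.Build B image imageV.

End Image.

Section Preimage.
Variables (A B : groupType) (f : UMagmaMorphism.type A B) (S : groupClosed B).

Definition preimage : {pred A} := fun x => f x \in S.

Lemma preimageE x : (x \in preimage) = (f x \in S).
Proof. by []. Qed.

Lemma preimage1 : 1 \in preimage.
Proof. by rewrite preimageE gmulf1 gpred1. Qed.

Lemma preimageM : mulg_closed preimage.
Proof. by move=> x y; rewrite !preimageE gmulfM; exact: gpredM. Qed.

Lemma preimageV : invg_closed preimage.
Proof. by move=> x; rewrite !preimageE gmulfV; exact: gpredVr. Qed.

HB.instance Definition _ := isMulClosed.Build A preimage preimageM.
HB.instance Definition _ := isMul1Closed.Build A preimage preimage1.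
HB.instance Definition _ := isInvClosed.Build A preimage preimageV.

End Preimage.

Section Corestriction.
Variables (A B : groupType) (f : UMagmaMorphism.type A B) (S : groupClosed B).
Hypothesis fS : forall x, f x \in S.

Definition corestrict (x : A) : subgroup_type S := Sub (f x) (fS x).

Lemma val_corestrict x : val (corestrict x) = f x.
Proof. exact: SubK. Qed.

Lemma corestrict_morphism : monoid_morphism corestrict.
Proof.
by split=> [|x y]; apply: val_inj;
  rewrite ?gmulfM ?gmulf1 /= ?gmulfM ?gmulf1.
Qed.

HB.instance Definition _ :=
  isUMagmaMorphism.Build A (subgroup_type S) corestrict corestrict_morphism.

End Corestriction.

Section SubgroupIsomorphism.
Variables (A B : groupType) (f : UMagmaMorphism.type A B).
Variables (T : groupClosed A) (S : groupClosed B).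

(** [T] and [S] may live in different ambient groups: here they will be the
derived group of a subgroup [K] of [aut G], and [inn G] in [aut G] itself. *)
Lemma isomorphic_subgroup :
    injective f -> (forall x, x \in T -> f x \in S) ->
    (forall y, y \in S -> exists2 x, x \in T & f x = y) ->
  isomorphic (subgroup_type T) (subgroup_type S).
Proof.
move=> finj fTS fonto.
pose fT : UMagmaMorphism.type (subgroup_type T) B := f \o val.
have fTP (x : subgroup_type T) : fT x \in S by exact/fTS/(valP x).
exists (corestrict fTP).
have onto (y : subgroup_type S) : exists x, corestrict fTP x = y.
  have [x xT fx] := fonto _ (valP y).
  by exists (Sub x xT); apply: val_inj.
pose g y := sval (cid (onto y)).
have gK : cancel g (corestrict fTP) by move=> y; exact: svalP (cid (onto y)).
exists g => // x; apply/val_inj/finj.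
by rewrite -[f _](val_corestrict fTP) gK.
Qed.

End SubgroupIsomorphism.

Lemma commg_derived (A : groupType) (x y : A) : [~ x, y] \in derived A.
Proof. by apply/derivedP => S; apply. Qed.

(** [x ^ h] differs from [x] by the commutator of [x] and [h]. *)
Lemma derivedJ (A : groupType) (x h : A) :
  x \in derived A -> x ^ h \in derived A.
Proof.
move=> xD; rewrite -(mulVKg x (x ^ h)) -commgEl.
by apply: gpredM => //; exact: commg_derived.
Qed.

Section DerivedMorphism.
Variables (A B : groupType) (f : UMagmaMorphism.type A B).

(** The preimage of a subgroup containing the commutators of [B] contains
those of [A]. *)
Lemma derived_morph x : x \in derived A -> f x \in derived B.
Proof.
move=> /derivedP xD; apply/derivedP => S cS; rewrite -preimageE.
by apply: xD => y z; rewrite preimageE gmulfR.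
Qed.

(** The image of [derived A] is a subgroup which, by surjectivity, contains
all commutators of [B]. *)
Lemma derived_surj y :
    (forall b, exists a, f a = b) ->
  y \in derived B -> exists2 x, x \in derived A & f x = y.
Proof.
move=> fonto /derivedP yD.
pose fD : UMagmaMorphism.type (subgroup_type (derived A)) B := f \o val.
have /imageP[x <-] : y \in image fD.
  apply: yD => a b; have [a' <-] := fonto a; have [b' <-] := fonto b.
  pose c : subgroup_type (derived A) := Sub [~ a', b'] (commg_derived a' b').
  by apply/imageP; exists c; rewrite /= gmulfR.
by exists (val x) => //; exact: valP.
Qed.

End DerivedMorphism.

Section ConjugationAction.
Variables (H G : groupType) (N : groupClosed H).
Hypothesis normalN : forall x h, x \in N -> x ^ h \in N.
Variables (phi : UMagmaMorphism.type (subgroup_type N) G).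
Variables (psi : G -> subgroup_type N).
Hypotheses (phiK : cancel phi psi) (psiK : cancel psi phi).

Definition conj_sub (h : H) (n : subgroup_type N) : subgroup_type N :=
  Sub (val n ^ h) (normalN h (valP n)).

Lemma val_conj_sub h n : val (conj_sub h n) = val n ^ h.
Proof. exact: SubK. Qed.

Definition conj_action_fun (h : H) (x : G) : G := phi (conj_sub h (psi x)).

Lemma conj_action_funM h k x :
  conj_action_fun (h * k) x = conj_action_fun k (conj_action_fun h x).
Proof.
rewrite /conj_action_fun phiK; congr (phi _).
by apply: val_inj; rewrite !val_conj_sub conjgM.
Qed.

Lemma conj_action_fun1 x : conj_action_fun 1 x = x.
Proof.
rewrite -[RHS]psiK; congr (phi _).
by apply: val_inj; rewrite val_conj_sub conjg1.
Qed.

Lemma conj_action_is_aut h : conj_action_fun h \in is_aut G.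
Proof.
have psiM x y : psi (x * y) = psi x * psi y.
  by apply: (can_inj phiK); rewrite gmulfM !psiK.
have psi1 : psi 1 = 1 by apply: (can_inj phiK); rewrite gmulf1 psiK.
apply/is_autP; split; last first.
  exists (conj_action_fun h^-1) => x;
  by rewrite -conj_action_funM ?mulgV ?mulVg conj_action_fun1.
split=> [|x y].
  rewrite -[RHS](gmulf1 (s := phi)); congr (phi _).
  by apply: val_inj; rewrite val_conj_sub psi1 gmulf1 conj1g.
rewrite /conj_action_fun -gmulfM; congr (phi _).
by apply: val_inj; rewrite gmulfM !val_conj_sub psiM gmulfM conjMg.
Qed.

Definition conj_action (h : H) : aut G := Aut (conj_action_is_aut h).

(** Right conjugation turns a product into a composition from left to right,
which is the order of the product of [aut G]. *)
Lemma conj_action_morphism : monoid_morphism conj_action.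
Proof.
split=> [|h k]; apply/autP => x; first exact: conj_action_fun1.
exact: conj_action_funM.
Qed.

HB.instance Definition _ :=
  isUMagmaMorphism.Build H (aut G) conj_action conj_action_morphism.

(** For [n] in [N], the conjugation carried over to [G] already takes place
inside [N], and isomorphisms commute with conjugation. *)
Lemma conj_action_inner (n : subgroup_type N) x :
  conj_action (val n) x = x ^ phi n.
Proof.
rewrite -[x in RHS]psiK -gmulfJ; congr (phi _).
by apply: val_inj; rewrite val_conj_sub gmulfJ.
Qed.

Lemma conj_action_inn h : h \in N -> conj_action h \in inn G.
Proof.
move=> hN; apply/innP; exists (phi (Sub h hN)) => x.
by rewrite -conj_action_inner SubK.
Qed.

Lemma conj_action_onto_inn f :
  f \in inn G -> exists2 h, h \in N & conj_action h = f.
Proof.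
move=> /innP[g fg]; exists (val (psi g)); first exact: valP.
by apply/autP => x; rewrite conj_action_inner psiK fg.
Qed.

End ConjugationAction.

Theorem theorem3p2 (G : groupType) (hG : integrable G) :
  {subset inn G <= derived (aut G)} /\
  exists K : groupClosed (aut G),
    is_integral_of (subgroup_type K) (subgroup_type (inn G)).
Proof.
have [H [phi [psi phiK psiK]]] := hG.
pose rho : UMagmaMorphism.type H (aut G) :=
  conj_action (fun x h => @derivedJ H x h) phiK psiK.
have rho_inn h : h \in derived H -> rho h \in inn G by exact: conj_action_inn.
have rho_onto f : f \in inn G -> exists2 h, h \in derived H & rho h = f.
  exact: conj_action_onto_inn.
split=> [f /rho_onto[h hD <-]|]; first exact: derived_morph.
pose K : groupClosed (aut G) := image rho.
exists K.
pose rhoK : UMagmaMorphism.type H (subgroup_type K) :=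
  corestrict (image_f rho).
have rhoK_onto k : exists h, rhoK h = k.
  by have /imageP[h rho_h] := valP k; exists h; apply: val_inj.
apply: (isomorphic_subgroup (f := val)) => [|k kD|f /rho_onto[h hD <-]].
- exact: val_inj.
- have [h hD <-] := derived_surj rhoK_onto kD.
  exact: rho_inn.
- by exists (rhoK h) => //; exact: derived_morph.
Qed.
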